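(* Let $\mathcal{P}\subseteq\mathbb{R}^3_{\geq 0}$ be a symmetric lattice polytope that is 2-partition maximal, with $\operatorname{MLP}(\mathcal{P})=\{\lambda,\mu\}$, where $\lambda=(\lambda_1,\lambda_2,\lambda_3)$ and $\mu=(\mu_1,\mu_2,\mu_3)$ are distinct partitions of the same size. Then for every positive integer $t$ the polynomial $$ts=\sum_{i=0}^t s_{(t-i)\lambda+i\mu}\in\mathbb{Z}[x_1,x_2,x_3]$$ has saturated Newton polytope.
   Context: A lattice polytope in $\mathbb{R}^n$ is the convex hull of a nonempty finite set of points of $\mathbb{Z}^n$. A polytope $\mathcal{P}\subseteq\mathbb{R}^n$ is symmetric if $\pi\mathcal{P}=\mathcal{P}$ for every permutation $\pi$ of $\{1,\dots,n\}$, acting by permuting coordinates. For a polynomial $f=\sum_\alpha c_\alpha x^\alpha\in\mathbb{R}[x_1,\dots,x_n]$, $\operatorname{Supp}(f)=\{\alpha : c_\alpha\neq 0\}$ and $\operatorname{Newt}(f)$ is the convex hull of $\operatorname{Supp}(f)$. $f$ has saturated Newton polytope (SNP) if every point of $\operatorname{Newt}(f)\cap\mathbb{Z}^n$ is an exponent vector of $f$, i.e. lies in $\operatorname{Supp}(f)$. A partition in $\mathbb{R}^n$ is a vector $\lambda=(\lambda_1,\dots,\lambda_n)\in\mathbb{Z}^n$ with $\lambda_1\geq\cdots\geq\lambda_n\geq 0$ (trailing zeros allowed); its size is the sum of its entries, and partitions are added and scaled coordinatewise. The Schur polynomial is $s_\lambda=\sum_\alpha K_{\lambda,\alpha}x_1^{\alpha_1}\cdots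 x_n^{\alpha_n}$, where $K_{\lambda,\alpha}$ is the number of semistandard Young tableaux (rows weakly increasing, columns strictly increasing) of shape $\lambda$ and content $\alpha=(\alpha_1,\dots,\alpha_n)$, i.e. with $\alpha_i$ entries equal to $i$; here $n=3$. For partitions $\lambda,\mu$ of the same size, $\lambda\trianglelefteq\mu$ (dominance order) means $\sum_{i=1}^k\lambda_i\leq\sum_{i=1}^k\mu_i$ for all $k$; partitions of different sizes are incomparable. For a symmetric polytope $\mathcal{P}$, $\operatorname{LP}(\mathcal{P})$ is the set of lattice points of $\mathcal{P}$ that are partitions, and $\operatorname{MLP}(\mathcal{P})$ is the set of $\trianglelefteq$-maximal elements of $\operatorname{LP}(\mathcal{P})$. $\mathcal{P}$ is 2-partition maximal if there are two (distinct) partitions $\lambda,\mu$ with $\operatorname{MLP}(\mathcal{P})=\{\lambda,\mu\}$. The symbol $ts$ denotes the polynomial displayed in the claim, not a scalar multiple of $s=s_\lambda+s_\mu$. *)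

(* Defs.v *)
From HB Require Import structures.
From mathcomp Require Import all_boot all_order all_fingroup all_algebra.
From mathcomp Require Import boolp classical_sets reals.
From mathcomp Require Import mpoly.

Set Implicit Arguments.
Unset Strict Implicit.
Unset Printing Implicit Defensive.

Import Order.TTheory GRing.Theory Num.Theory.
Local Open Scope ring_scope.

Section Schur.
Variable n : nat.
Implicit Types (l a : 'X_{1..n}).

(* Cells (row, column) of the Young diagram, both indices starting at 0. *)
Definition cell l := {i : 'I_n & 'I_(l i)}.

(* Entries are indexed from 0 as well; restricting them to n letters is
   harmless since only contents in N^n are considered. *)
Definition filling l := {ffun cell l -> 'I_n}.

Definition is_ssyt l (T : filling l) : bool :=
  [forall c : cell l, forall d : cell l,
     ((tag c == tag d) && (tagged c <= tagged d)%N ==> (T c <= T d)%N) &&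
     ((tagged c == tagged d :> nat) && (tag c < tag d)%N ==> (T c < T d)%N)].

Definition content l (T : filling l) : 'X_{1..n} :=
  [multinom #|[set c | T c == i]| | i < n].

Definition kostka l a : nat :=
  #|[set T : filling l | is_ssyt T & content T == a]|.

(* The truncation of the sum to degree at most mdeg l is immaterial: see
   mcoeff_schur. *)
Definition schur l : {mpoly int[n]} :=
  \sum_(a : 'X_{1..n < (mdeg l).+1}) (kostka l a)%:R *: 'X_[a].

Lemma mdeg_content l (T : filling l) : mdeg (content T) = mdeg l.
Proof.
transitivity #|{: cell l}|; last first.
  by rewrite card_tagged sumnE big_map big_enum /= mdegE; apply: eq_bigr => i _; rewrite card_ord.
rewrite mdegE -sum1_card (partition_big T xpredT) //=.
by apply: eq_bigr => i _; rewrite mnmE -sum1_card; apply: eq_bigl => c; rewrite inE.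
Qed.

Lemma mcoeff_schur l a : (schur l)@_a = (kostka l a)%:R.
Proof.
rewrite /schur raddf_sum /=.
have [da|da] := ltnP (mdeg a) (mdeg l).+1.
  rewrite (bigD1 (BMultinom da)) //= mcoeffZ mcoeffX eqxx mulr1.
  rewrite big1 ?addr0 // => b nb; rewrite mcoeffZ mcoeffX.
  by rewrite (_ : (_ == a) = false) ?mulr0 //; apply: contraNF nb => /eqP ba; apply/eqP/val_inj.
rewrite big1 => [|b _].
  rewrite (_ : kostka l a = 0%N) //; apply/eqP; rewrite cards_eq0; apply/eqP/setP=> T.
  rewrite !inE; apply/negP => /andP[_ /eqP aE].
  by move: da; rewrite -aE mdeg_content ltnn.
rewrite mcoeffZ mcoeffX; case: eqP => [ba|]; last by rewrite mulr0.
by have := bmdeg b; rewrite ba ltnNge da.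
Qed.

End Schur.

Local Open Scope classical_set_scope.

Section Polytopes.
Variables (R : realType) (n : nat).
Implicit Types (S P : set 'rV[R]_n).

Definition conv_hull S : set 'rV[R]_n :=
  [set x | exists (k : nat) (w : 'I_k -> R) (p : 'I_k -> 'rV[R]_n),
     [/\ forall i, 0 <= w i, \sum_i w i = 1, forall i, S (p i)
       & x = \sum_i w i *: p i]].

Definition lattice_vec (z : 'rV[int]_n) : 'rV[R]_n := map_mx intr z.

Definition lattice_points : set 'rV[R]_n := range lattice_vec.

Definition lattice_polytope P : Prop :=
  exists s : seq 'rV[int]_n,
    s != [::] /\ P = conv_hull [set lattice_vec z | z in [set` s]].

Definition symmetric_set P : Prop :=
  forall s : 'S_n, [set col_perm s x | x in P] = P.

Definition mnm_vec (a : 'X_{1..n}) : 'rV[R]_n := \row_i (a i)%:R.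

Definition Newt (A : nzRingType) (f : {mpoly A[n]}) : set 'rV[R]_n :=
  conv_hull [set mnm_vec a | a in [set` msupp f]].

Definition saturated_Newton (A : nzRingType) (f : {mpoly A[n]}) : Prop :=
  Newt f `&` lattice_points `<=` [set mnm_vec a | a in [set` msupp f]].

End Polytopes.

(* Partitions in R^n are the weakly decreasing elements of 'X_{1..n}, i.e. of
   N^n; the size of a partition is mdeg. *)
Definition is_partition n (l : 'X_{1..n}) : Prop :=
  forall i j : 'I_n, (i <= j)%N -> (l j <= l i)%N.

Definition dominated n (l m : 'X_{1..n}) : Prop :=
  mdeg l = mdeg m /\
  forall k : nat, (\sum_(i < n | (i < k)%N) l i <= \sum_(i < n | (i < k)%N) m i)%N.

Definition LP (R : realType) n (P : set 'rV[R]_n) : set 'X_{1..n} :=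
  [set l | is_partition l /\ P (mnm_vec R l)].

Definition MLP (R : realType) n (P : set 'rV[R]_n) : set 'X_{1..n} :=
  [set l | LP P l /\ forall m, LP P m -> dominated l m -> m = l].

Definition two_partition_maximal (R : realType) n (P : set 'rV[R]_n) : Prop :=
  exists l m : 'X_{1..n},
    [/\ is_partition l, is_partition m, l <> m & MLP P = [set l; m]].

(* Main.v *)
Require Import Defs.
From HB Require Import structures.
From mathcomp Require Import all_boot all_order all_fingroup all_algebra.
From mathcomp Require Import boolp classical_sets reals.
From mathcomp Require Import mpoly.
From mathcomp Require Import zify ring lra.

Set Implicit Arguments.
Unset Strict Implicit.
Unset Printing Implicit Defensive.

Import Order.TTheory GRing.Theory Num.Theory.
Local Open Scope classical_set_scope.
Local Open Scope ring_scope.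

(** With three variables, a vector [a] of size [mdeg l] is an exponent of
    [schur l] exactly when every entry of [a] lies between the last and the
    first part of [l] ([kostka3_gt0]): dominance between partitions of the same
    size with three parts only compares first and last parts.

    Two incomparable partitions [l] and [m] can thus be ordered so that [l] has
    both the larger first part and the larger last part; let [p] and [q] be the
    two differences.  The support of the sum is the union, over the integers
    [0 <= i <= t], of the lattice points of the hexagons [H_i] where all
    coordinates lie between [t * l_3 - i * q] and [t * l_1 - i * p] and sum to
    [t * mdeg l].  Both bounds are affine in [i], so a point of the Newton
    polytope satisfies the inequalities of [H_T] for some real [0 <= T <= t],
    namely the weighted average of the indices of the exponents that it
    combines ([Newt_segment_sum]).

    For a lattice point one has to replace [T] by an integer.  Writing [hi] and
    [lo] for its extreme coordinates, the admissible times form the interval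
    from [(t * l_3 - lo) / q] to [(t * l_1 - hi) / p], cut down to times
    between 0 and [t].
    It contains an integer as soon as it is nonempty and one of its ends is an
    integer, hence as soon as [p = 1] or [q = 1] ([integral_time]).

    The polytope [P] forces this ([MLP_unit_gap]).  If [p] and [q] were both at
    least 2, the partition [m + (1, - q, q - 1)] would lie in [P], because it is
    obtained from a point of the segment joining [l] and [m] by moving weight
    from the first coordinate to the second.  It is dominated neither by [l],
    as its last part is [l_3 - 1], nor by [m], as its first part is [m_1 + 1],
    although every partition of [P] lies below a maximal one
    ([LP_dominated_MLP]). *)

(** * Contents of semistandard tableaux *)

Section Columns.
Variables (n : nat) (l : 'X_{1..n.+1}) (l_part : is_partition l).

(** All columns are indexed by the columns of the first row, so that columns of
    cells from different rows can be compared. *)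
Definition column (c : cell l) : 'I_(l ord0) :=
  widen_ord (l_part (i := ord0) (leq0n (tag c))) (tagged c).

(** A column of a semistandard tableau has strictly increasing entries, so it
    contains each letter at most once. *)
Lemma ssyt_column_inj (T : filling l) (c d : cell l) :
  is_ssyt T -> T c = T d -> column c = column d -> c = d.
Proof.
move=> /forallP ssT eqT /(congr1 val) /= eqcol.
have [lt_cd|lt_dc|/val_inj eq_cd] := ltngtP (tag c) (tag d).
- have /andP[_ /implyP] := forallP (ssT c) d.
  by rewrite eqcol eqxx lt_cd eqT ltnn => /(_ isT).
- have /andP[_ /implyP] := forallP (ssT d) c.
  by rewrite eqcol eqxx lt_dc eqT ltnn => /(_ isT).
move: c d eqcol eq_cd {eqT} => [r j] [r' j'] /= eqj eqr.
by subst r'; congr (Tagged _ _); apply: val_inj.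
Qed.

Lemma content_le_first (T : filling l) (i : 'I_n.+1) :
  is_ssyt T -> (content T i <= l ord0)%N.
Proof.
move=> ssT; rewrite mnmE -(card_in_imset (f := column)).
  by rewrite -[leqRHS]card_ord max_card.
move=> c d; rewrite !inE => /eqP Tc /eqP Td.
by apply: (ssyt_column_inj ssT); rewrite Tc Td.
Qed.

(** A column of full height holds [n.+1] distinct letters out of [n.+1], hence
    all of them. *)
Lemma last_le_content (T : filling l) (i : 'I_n.+1) :
  is_ssyt T -> (l ord_max <= content T i)%N.
Proof.
move=> ssT; rewrite mnmE.
have le_last : (l ord_max <= l ord0)%N by apply: l_part.
have widen_inj : injective (widen_ord le_last).
  by move=> j k /(congr1 val) eq_jk; apply: val_inj.
rewrite -[leqLHS]card_ord -(card_imset _ widen_inj).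
apply: leq_trans (leq_imset_card column _).
apply/subset_leq_card/fintype.subsetP => _ /imsetP[j _ ->].
pose cellj (r : 'I_n.+1) : cell l :=
  Tagged (fun r => 'I_(l r)) (widen_ord (l_part (j := ord_max) (leq_ord r)) j).
have cellj_inj : injective (fun r => T (cellj r)).
  move=> r s /(ssyt_column_inj ssT) eqc.
  by apply: (congr1 tag (eqc _)); apply: val_inj.
have /codomP[r Tr] : i \in codom (fun r => T (cellj r)).
  exact: (injF_onto cellj_inj).
by apply/imsetP; exists (cellj r); [rewrite inE Tr | apply: val_inj].
Qed.

End Columns.

(** * Supports of Schur polynomials in three variables *)

Definition mid3 : 'I_3 := Ordinal (isT : (1 < 3)%N).

Lemma ord3P (Q : 'I_3 -> Prop) :
  Q ord0 -> Q mid3 -> Q ord_max -> forall r, Q r.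
Proof.
move=> Q0 Q1 Q2 [[|[|[|//]]] r_lt3].
- by rewrite (_ : Ordinal _ = ord0) //; apply: val_inj.
- by rewrite (_ : Ordinal _ = mid3) //; apply: val_inj.
- by rewrite (_ : Ordinal _ = ord_max) //; apply: val_inj.
Qed.

Lemma sum_ord3 (V : nmodType) (F : 'I_3 -> V) :
  \sum_(r < 3) F r = F ord0 + F mid3 + F ord_max.
Proof.
rewrite !big_ord_recl big_ord0 addr0 addrA.
by congr (_ + F _ + F _); apply: val_inj.
Qed.

Lemma mdeg3 (a : 'X_{1..3}) : mdeg a = (a ord0 + a mid3 + a ord_max)%N.
Proof. by rewrite mdegE sum_ord3. Qed.

Lemma contentE n (l : 'X_{1..n}) (T : filling l) i :
  content T i =
  (\sum_(r < n) \sum_(j < l r) (T (Tagged (fun r => 'I_(l r)) j) == i))%N.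
Proof.
rewrite mnmE -sum1_card big_mkcond /=.
rewrite (sig_big_dep _ _ (fun r (j : 'I_(l r)) =>
  (T (Tagged (fun r => 'I_(l r)) j) == i : nat))) /=.
by apply: eq_bigr => -[r j] _; rewrite inE /=; case: eqP.
Qed.

Lemma sum_ltn_interval m a b :
  (\sum_(j < m) ((a <= j) && (j < b)) = minn m b - a)%N.
Proof.
elim: m => [|m IHm]; first by rewrite big_ord0; lia.
by rewrite big_ord_recr /= IHm; lia.
Qed.

(** The converse of the two bounds above, for three letters.  The entries other
    than the largest letter occupy a shape of two rows that has to interlace
    with [l], and the smallest letter a shape of one row, of length [a ord0],
    that has to interlace with it in turn. *)

Section Existence.
Variables (l a : 'X_{1..3}).
Hypotheses (l_part : is_partition l) (deg_eq : mdeg a = mdeg l).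
Hypothesis a_bounds : forall r, (l ord_max <= a r <= l ord0)%N.

(** The two rows of the shape occupied by the entries 0 and 1.  The conditions of
    [interlacing3] define an interval for the length of the first row, which
    determines the second one; the upper end of that interval is taken. *)
Definition sub_row0 := minn (l ord0) (a ord0 + a mid3 - l ord_max).
Definition sub_row1 := (a ord0 + a mid3 - sub_row0)%N.

Definition entry3 (r j : nat) : nat :=
  match r with
  | 0 => (a ord0 <= j) + (sub_row0 <= j)
  | 1 => 1 + (sub_row1 <= j)
  | _ => 2
  end.

Definition tableau3 : filling l :=
  [ffun c : cell l => inord (entry3 (tag c) (tagged c))].

Lemma tableau3E (c : cell l) : tableau3 c = entry3 (tag c) (tagged c) :> nat.
Proof.
rewrite ffunE inordK // /entry3.
case: c => r j /=; case: (nat_of_ord r) => [|[|?]] //=; lia.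
Qed.

Lemma interlacing3 :
  [/\ (l mid3 <= sub_row0 <= l ord0)%N, (l ord_max <= sub_row1 <= l mid3)%N,
      (sub_row1 <= a ord0 <= sub_row0)%N
    & (sub_row0 + sub_row1 = a ord0 + a mid3)%N].
Proof.
have := a_bounds ord0; have := a_bounds mid3; have := a_bounds ord_max.
have := l_part (i := ord0) (leq0n mid3); have := l_part (j := ord_max) (leq_ord mid3).
move: deg_eq; rewrite !mdeg3 /sub_row1 /sub_row0.
move: (a ord0) (a mid3) (a ord_max) (l ord0) (l mid3) (l ord_max) => *; split; lia.
Qed.

Lemma tableau3_ssyt : is_ssyt tableau3.
Proof.
have [h0 h1 h2 h3] := interlacing3.
apply/forallP => c; apply/forallP => d; rewrite !tableau3E.
move: c d => -[r j] -[s k] /=; rewrite -(inj_eq val_inj) /=.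
move: r s j k; apply: ord3P; apply: ord3P => /= j k;
  have := ltn_ord j; have := ltn_ord k; rewrite /entry3; lia.
Qed.

Lemma content_tableau3 : content tableau3 = a.
Proof.
have [h0 h1 h2 h3] := interlacing3.
have c0 : content tableau3 ord0 = a ord0.
  rewrite contentE sum_ord3.
  rewrite (eq_bigr (fun j : 'I_(l ord0) =>
    nat_of_bool (0 <= j < a ord0)%N)); last first.
    move=> j _; rewrite -(inj_eq val_inj) /= tableau3E /entry3 /=; lia.
  rewrite sum_ltn_interval.
  rewrite !big1; [by move: h0 h2; lia | |] => j _;
    rewrite -(inj_eq val_inj) /= tableau3E /entry3 /=; lia.
have c1 : content tableau3 mid3 = a mid3.
  rewrite contentE sum_ord3.
  rewrite (eq_bigr (fun j : 'I_(l ord0) =>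
    nat_of_bool (a ord0 <= j < sub_row0)%N)); last first.
    move=> j _; rewrite -(inj_eq val_inj) /= tableau3E /entry3 /=; lia.
  rewrite sum_ltn_interval.
  rewrite (eq_bigr (fun j : 'I_(l mid3) =>
    nat_of_bool (0 <= j < sub_row1)%N)); last first.
    move=> j _; rewrite -(inj_eq val_inj) /= tableau3E /entry3 /=; lia.
  rewrite sum_ltn_interval.
  rewrite big1; first (move: h0 h1 h2 h3; lia).
  move=> j _; rewrite -(inj_eq val_inj) /= tableau3E /entry3 /=; lia.
apply/mnmP; apply: ord3P => //.
by have := mdeg_content tableau3; rewrite -deg_eq !mdeg3 c0 c1 => /addnI.
Qed.

End Existence.

(** Kostka numbers are positive exactly when the content is dominated by the
    shape; for three letters this amounts to bounds on each entry, which do not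
    require the content to be sorted. *)
Lemma kostka3_gt0 (l a : 'X_{1..3}) : is_partition l ->
  (0 < kostka l a)%N =
  (mdeg a == mdeg l) && [forall r, l ord_max <= a r <= l ord0]%N.
Proof.
move=> l_part; apply/idP/idP.
  rewrite card_gt0 => /set0Pn[T]; rewrite inE => /andP[ssT /eqP <-].
  rewrite mdeg_content eqxx; apply/forallP => r.
  by rewrite last_le_content ?content_le_first.
move=> /andP[/eqP deg_eq /forallP bounds].
rewrite card_gt0; apply/set0Pn; exists (tableau3 l a).
by rewrite inE tableau3_ssyt ?content_tableau3 ?eqxx.
Qed.

(** Kostka numbers are nonnegative, so that supports cannot cancel in a sum. *)
Lemma mem_msupp_sum_schur n (m : nat) (nu : 'I_m -> 'X_{1..n}) a :
  (a \in msupp (\sum_(i < m) schur (nu i))) = [exists i, 0 < kostka (nu i) a]%N.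
Proof.
rewrite mcoeff_msupp raddf_sum /= (eq_bigr _ (fun i _ => mcoeff_schur (nu i) a)).
rewrite -natr_sum pnatr_eq0 sum_nat_eq0 negb_forall.
by apply: eq_existsb => i; rewrite lt0n.
Qed.

(** * Convexity and symmetry *)

Section Convexity.
Variables (R : realType) (n : nat).
Implicit Types (S P : set 'rV[R]_n) (x y : 'rV[R]_n).

Definition convex_subset P : Prop := forall x y (c : R),
  0 <= c <= 1 -> P x -> P y -> P ((1 - c) *: x + c *: y).

Lemma conv_hull_convex S : convex_subset (conv_hull S).
Proof.
move=> x y c /andP[c_ge0 c_le1] [j [v [p [v_ge0 v_sum1 pS ->]]]].
move=> [k [w [q [w_ge0 w_sum1 qS ->]]]].
exists (j + k)%N.
exists (fun i => match split i with inl a => (1 - c) * v a | inr b => c * w b end).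
exists (fun i => match split i with inl a => p a | inr b => q b end).
have splitL a : split (lshift k a) = inl a :> 'I_j + 'I_k := unsplitK (inl a).
have splitR b : split (rshift j b) = inr b :> 'I_j + 'I_k := unsplitK (inr b).
split.
- by move=> i; case: (split i) => a; rewrite mulr_ge0 // subr_ge0.
- rewrite big_split_ord /=.
  under eq_bigr do rewrite splitL.
  under [X in _ + X = _]eq_bigr do rewrite splitR.
  by rewrite -!mulr_sumr v_sum1 w_sum1 !mulr1 subrK.
- by move=> i; case: (split i).
- rewrite big_split_ord /= !scaler_sumr; congr (_ + _); apply: eq_bigr => i _.
    by rewrite splitL scalerA.
  by rewrite splitR scalerA.
Qed.

(** Moving an amount [e] from coordinate [i] to coordinate [j] without exceeding
    their difference is averaging [x] with its image under the transposition
    of [i] and [j]. *)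
Lemma transfer_mem P x (i j : 'I_n) (e : R) :
  convex_subset P -> symmetric_set P -> P x -> 0 <= e <= x ord0 i - x ord0 j ->
  P (x + e *: (delta_mx ord0 j - delta_mx ord0 i)).
Proof.
move=> P_cvx P_sym Px /andP[e_ge0 e_le].
have [xij|xij] := eqVneq (x ord0 i) (x ord0 j).
  have -> : e = 0 by apply/le_anti; rewrite e_ge0 (le_trans e_le) // xij subrr.
  by rewrite scale0r addr0.
have Pswap : P (col_perm (tperm i j) x) by rewrite -(P_sym (tperm i j)); exists x.
have gap_gt0 : 0 < x ord0 i - x ord0 j.
  by rewrite lt_neqAle eq_sym subr_eq0 xij (le_trans e_ge0).
have c01 : 0 <= e / (x ord0 i - x ord0 j) <= 1.
  by rewrite ler_pdivrMr // mul1r e_le andbT divr_ge0 // ltW.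
have := P_cvx _ _ _ c01 Px Pswap; congr P; apply/rowP => r.
rewrite !mxE /=.
have gap_neq0 : x ord0 i - x ord0 j != 0 by rewrite gt_eqF.
have ij : i != j by apply: contraNneq xij => ->.
have [->|ri] := eqVneq r i.
  by rewrite tpermL ?eqxx (negPf ij) /=; field.
have [->|rj] := eqVneq r j.
  by rewrite tpermR /=; field.
by rewrite tpermD 1?eq_sym //=; field.
Qed.

End Convexity.

(** * Maximal partitions *)

Section Dominance.
Variable n : nat.
Implicit Types l m : 'X_{1..n}.

Definition partial_sum l k := (\sum_(i < n | (i < k)%N) l i)%N.

(** A natural number that strictly increases along dominance and is bounded for
    a fixed size: dominance chains are therefore finite. *)
Definition dominance_rank l := (\sum_(k < n.+1) partial_sum l k)%N.

Lemma partial_sum_inj l m :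
  (forall k : 'I_n.+1, partial_sum l k = partial_sum m k) -> l = m.
Proof.
move=> eqS; apply/mnmP => i.
have step a : partial_sum a i.+1 = (a i + partial_sum a i)%N.
  rewrite /partial_sum (bigD1 i) //=; congr (_ + _)%N; apply: eq_bigl => r.
  by rewrite ltnS ltn_neqAle andbC.
have := eqS (lift ord0 i); rewrite /= /bump /= add1n !step.
have := eqS (widen_ord (leqnSn n) i); rewrite /= => ->.
by move/addIn.
Qed.

Lemma dominance_rank_lt l m :
  dominated l m -> l <> m -> (dominance_rank l < dominance_rank m)%N.
Proof.
move=> [_ le_lm] neq_lm.
have := leqif_sum (P := xpredT)
  (fun (k : 'I_n.+1) _ => leqif_eq (le_lm k : partial_sum l k <= partial_sum m k)%N).
rewrite ltn_neqAle => -[-> ->]; rewrite andbT; apply/forallP => /= eqS.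
by apply: neq_lm; apply: partial_sum_inj => k; apply/eqP/eqS.
Qed.

Lemma dominance_rank_le l : (dominance_rank l <= n.+1 * mdeg l)%N.
Proof.
rewrite -[X in (X * _)%N]card_ord -sum_nat_const; apply: leq_sum => k _.
by rewrite mdegE /partial_sum big_mkcond; apply: leq_sum => i _; case: ifP.
Qed.

Lemma dominated_trans l m p : dominated l m -> dominated m p -> dominated l p.
Proof.
move=> [dlm lm] [dmp mp]; split; first by rewrite dlm.
by move=> k; apply: leq_trans (lm k) (mp k).
Qed.

Lemma LP_dominated_MLP (R : realType) (P : set 'rV[R]_n) l :
  LP P l -> exists2 m, MLP P m & dominated l m.
Proof.
have [N] := ubnP (n.+1 * mdeg l - dominance_rank l)%N.
elim: N l => // N IHN l le_N Pl.
have [maxl|] := pselect (forall m, LP P m -> dominated l m -> m = l).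
  by exists l.
move=> /existsNP[m /not_implyP[Pm /not_implyP[lm neq_ml]]].
have rank_lt := dominance_rank_lt lm (nesym neq_ml).
have rank_le := dominance_rank_le m; have [deg_lm _] := lm.
have [] := IHN m _ Pm; first by rewrite -deg_lm; rewrite -deg_lm in rank_le; lia.
by move=> p Pp mp; exists p => //; apply: dominated_trans mp.
Qed.

End Dominance.

Lemma partial_sum3 (l : 'X_{1..3}) k :
  partial_sum l k = ((0 < k) * l ord0 + (1 < k) * l mid3 + (2 < k) * l ord_max)%N.
Proof. by rewrite /partial_sum big_mkcond sum_ord3 /=; do 3![case: ifP => _]; lia. Qed.

Lemma dominated3P (l m : 'X_{1..3}) : mdeg l = mdeg m ->
  dominated l m <-> (l ord0 <= m ord0)%N /\ (m ord_max <= l ord_max)%N.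
Proof.
rewrite /dominated => deg_lm; split=> [[_ le_lm]|[le0 le2]].
  move: (le_lm 1%N) (le_lm 2%N) deg_lm; rewrite !mdeg3 -!/(partial_sum _ _).
  by rewrite !partial_sum3; lia.
split=> // k; move: deg_lm; rewrite !mdeg3 -!/(partial_sum _ _) !partial_sum3.
by case: k => [|[|[|k]]] /=; lia.
Qed.

(** If both gaps [p] and [q] were at least 2, the point at time [1 / q] on the
    segment from [l] to [m] would have last coordinate [l ord_max - 1] and first
    coordinate at least [m ord0 + 1]; lowering the latter to [m ord0 + 1] by a
    transfer gives a partition of [P] that neither [l] nor [m] dominates. *)
Lemma MLP_unit_gap (R : realType) (P : set 'rV[R]_3) (l m : 'X_{1..3}) :
  convex_subset P -> symmetric_set P -> MLP P = [set l; m] -> mdeg l = mdeg m ->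
  (m ord0 < l ord0)%N -> (m ord_max < l ord_max)%N ->
  l ord0 = (m ord0).+1 \/ l ord_max = (m ord_max).+1.
Proof.
move=> P_cvx P_sym MLPE deg_lm gap0 gap2.
have [l_part Pl] : LP P l by suff [] : MLP P l by []; rewrite MLPE; left.
have [m_part Pm] : LP P m by suff [] : MLP P m by []; rewrite MLPE; right.
apply: contrapT => /not_orP[/eqP gap0_neq1 /eqP gap2_neq1].
pose p := (l ord0 - m ord0)%N; pose q := (l ord_max - m ord_max)%N.
have p_ge2 : (2 <= p)%N by rewrite /p; lia.
have q_ge2 : (2 <= q)%N by rewrite /q; lia.
have l0E : l ord0 = (m ord0 + p)%N by rewrite /p; lia.
have l2E : l ord_max = (m ord_max + q)%N by rewrite /q; lia.
have m1E : m mid3 = (l mid3 + p + q)%N by move: deg_lm; rewrite !mdeg3; lia.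
clearbody p q.
have l01 : (l mid3 <= l ord0)%N by apply: l_part.
have l12 : (l ord_max <= l mid3)%N by apply: l_part.
have m01 : (m mid3 <= m ord0)%N by apply: m_part.
pose a : 'X_{1..3} := [multinom
  nth 0%N [:: (m ord0).+1; (l mid3 + p)%N; (l ord_max).-1] r | r < 3].
have a0 : a ord0 = (m ord0).+1 by rewrite mnmE.
have a1 : a mid3 = (l mid3 + p)%N by rewrite mnmE.
have a2 : a ord_max = (l ord_max).-1 by rewrite mnmE.
have a_part : is_partition a.
  by apply: ord3P; apply: ord3P => //=; rewrite ?a0 ?a1 ?a2 => _; lia.
have deg_al : mdeg a = mdeg l by rewrite !mdeg3 a0 a1 a2; lia.
have deg_am : mdeg a = mdeg m by rewrite deg_al.
have Pa : P (mnm_vec R a).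
  have pR : 2 <= p%:R :> R by rewrite ler_nat.
  have qR : 2 <= q%:R :> R by rewrite ler_nat.
  have q_neq0 : q%:R != 0 :> R by rewrite pnatr_eq0; lia.
  (* The first coordinate decreases by [u] at time [1 / q]. *)
  pose u : R := p%:R / q%:R.
  have u_le : u <= p%:R - 1 by rewrite ler_pdivrMr; nra.
  have u_ge0 : 0 <= u by rewrite divr_ge0.
  have c01 : 0 <= (q%:R^-1 : R) <= 1.
    by rewrite invr_ge0 ler0n /= invf_le1; lra.
  have := P_cvx _ _ _ c01 Pl Pm; set x := (X in P X) => Px.
  have x0 : x ord0 ord0 = (m ord0)%:R + p%:R - u.
    by rewrite !mxE l0E natrD /u; field.
  have x1 : x ord0 mid3 = (l mid3)%:R + u + 1.
    by rewrite !mxE m1E !natrD /u; field.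
  have x2 : x ord0 ord_max = (m ord_max)%:R + q%:R - 1.
    by rewrite !mxE l2E !natrD; field.
  have le_lm : (l mid3)%:R + p%:R <= (m ord0)%:R + 1 :> R.
    by rewrite -natrD natr1 ler_nat; lia.
  (* The amount to transfer is the excess of [x] over the target [m ord0 + 1]. *)
  have e_bounds : 0 <= p%:R - 1 - u <= x ord0 ord0 - x ord0 mid3.
    by rewrite x0 x1; lra.
  have := transfer_mem P_cvx P_sym Px e_bounds; congr P.
  apply/rowP; apply: ord3P; rewrite [LHS]mxE.
  - by rewrite x0 !mxE a0 -natr1 /=; ring.
  - by rewrite x1 !mxE a1 natrD /u /=; ring.
  - by rewrite x2 !mxE a2 l2E -subn1 natrB ?natrD /=; [ring | lia].
have [b] := LP_dominated_MLP (conj a_part Pa).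
rewrite MLPE => -[->|->].
  by case/(dominated3P deg_al); rewrite a2; lia.
by case/(dominated3P deg_am); rewrite a0; lia.
Qed.

(** * Rounding the time parameter *)

(** The inequality on [hi] bounds the time [T] from above and the one on [lo]
    bounds it from below.  A unit gap makes the corresponding bound an integer, and [T] can be
    moved to that bound, or to 0 or [t] if that comes first. *)
Lemma integral_time (R : realType) (t l0 l2 m0 m2 hi lo : nat) (T : R) :
  0 <= T <= t%:R -> (m0 < l0)%N -> (m2 < l2)%N ->
  l0 = m0.+1 \/ l2 = m2.+1 ->
  hi%:R <= l0%:R * (t%:R - T) + m0%:R * T ->
  l2%:R * (t%:R - T) + m2%:R * T <= lo%:R ->
  exists2 i : nat, (i <= t)%N &
    (hi <= l0 * (t - i) + m0 * i)%N /\ (l2 * (t - i) + m2 * i <= lo)%N.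
Proof.
move=> /andP[T_ge0 T_le] lt0 lt2 gap hi_le lo_ge.
have lt0R : m0%:R < l0%:R :> R by rewrite ltr_nat.
have lt2R : m2%:R < l2%:R :> R by rewrite ltr_nat.
case: gap => gapE.
  have hi_leR : T <= (l0 * t)%:R - hi%:R.
    by rewrite natrM; move: hi_le; rewrite gapE -natr1; lra.
  have hi_le_nat : (hi <= l0 * t)%N by rewrite -(ler_nat R); lra.
  exists (minn t (l0 * t - hi)); first exact: geq_minl.
  set i := minn _ _; have i_le : (i <= t)%N := geq_minl _ _.
  have T_le_i : T <= i%:R.
    rewrite /i /minn; case: ifP => // _.
    by rewrite natrB.
  split; first by rewrite gapE mulSn; rewrite gapE in hi_le_nat; rewrite /i gapE; nia.
  rewrite -(ler_nat R) natrD !natrM natrB //; apply: le_trans lo_ge; nra.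
(* With [l2 = m2.+1] the lower bound is an integer; truncated subtraction clips it at 0. *)
have lo_geR : (l2 * t)%:R - lo%:R <= T.
  by rewrite natrM; move: lo_ge; rewrite gapE -natr1; lra.
set i := (l2 * t - lo)%N.
have i_le_T : i%:R <= T.
  have [le|gt] := leqP lo (l2 * t); first by rewrite natrB.
  by rewrite /i (eqP (ltnW gt : (l2 * t - lo == 0)%N)).
have i_le : (i <= t)%N by rewrite -(ler_nat R) (le_trans i_le_T).
exists i => //; split.
  by rewrite -(ler_nat R) natrD !natrM natrB //; apply: le_trans hi_le _; nra.
by rewrite gapE mulSn; move: i_le; rewrite /i gapE; nia.
Qed.

Definition segment_sum (l m : 'X_{1..3}) t : {mpoly int[3]} :=
  \sum_(i < t.+1) schur (l *+ (t - i) + m *+ i)%MM.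

Lemma segment_partition n (l m : 'X_{1..n}) i j :
  is_partition l -> is_partition m -> is_partition (l *+ i + m *+ j)%MM.
Proof.
move=> l_part m_part r s le_rs; rewrite !mnmDE !mulmnE.
by rewrite leq_add // leq_mul2r ?l_part ?m_part ?orbT.
Qed.

Lemma mem_segment_sum (l m a : 'X_{1..3}) t :
  is_partition l -> is_partition m -> mdeg l = mdeg m ->
  reflect (mdeg a = (mdeg l * t)%N /\ exists2 i : nat, (i <= t)%N & forall r,
     (l ord_max * (t - i) + m ord_max * i <= a r
        <= l ord0 * (t - i) + m ord0 * i)%N)
    (a \in msupp (segment_sum l m t)).
Proof.
move=> l_part m_part deg_lm; rewrite mem_msupp_sum_schur.
have degE i : (i <= t)%N -> mdeg (l *+ (t - i) + m *+ i)%MM = (mdeg l * t)%N.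
  by move=> le_it; rewrite mdegD !mdegMn -deg_lm -mulnDr subnK.
have partE i := segment_partition (t - i) i l_part m_part.
apply: (iffP existsP) => [[i]|[deg_a [i le_it bounds]]].
  rewrite kostka3_gt0 // degE -1?ltnS // => /andP[/eqP-> /forallP bounds].
  split=> //; exists i; first by rewrite -ltnS.
  by move=> r; have := bounds r; rewrite !mnmDE !mulmnE.
exists (Ordinal (le_it : (i < t.+1)%N)).
rewrite kostka3_gt0 // degE // deg_a eqxx; apply/forallP => r.
by rewrite !mnmDE !mulmnE bounds.
Qed.

Section Saturation.
Variables (R : realType) (l m : 'X_{1..3}).
Hypotheses (l_part : is_partition l) (m_part : is_partition m).
Hypothesis deg_eq : mdeg l = mdeg m.

(** The bounds defining the support at index [i] are affine in [i], so they
    survive convex combinations once [i] is replaced by its average. *)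
Lemma Newt_segment_sum (t : nat) (x : 'rV[R]_3) :
  Newt (segment_sum l m t) x ->
  exists2 T : R, 0 <= T <= t%:R &
    \sum_r x ord0 r = (mdeg l * t)%:R /\ forall r, 0 <= x ord0 r /\
      (l ord_max)%:R * (t%:R - T) + (m ord_max)%:R * T <= x ord0 r
        <= (l ord0)%:R * (t%:R - T) + (m ord0)%:R * T.
Proof.
move=> [k [w [p [w_ge0 w_sum1 pS xE]]]].
have /choice[a aP] j :
    exists a, a \in msupp (segment_sum l m t) /\ mnm_vec R a = p j.
  by have [a ? ?] := pS j; exists a.
have /choice[i iP] j : exists i : nat, (i <= t)%N /\ forall r,
    (l ord_max * (t - i) + m ord_max * i <= a j r
       <= l ord0 * (t - i) + m ord0 * i)%N.
  have [/(mem_segment_sum _ _ l_part m_part deg_eq)[_ [i le_it bounds]] _] := aP j.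
  by exists i.
have mean_const (c : R) : \sum_j w j * c = c by rewrite -mulr_suml w_sum1 mul1r.
have aveE (A B : nat) : \sum_j w j * (A%:R * (t%:R - (i j)%:R) + B%:R * (i j)%:R) =
    A%:R * (t%:R - \sum_j w j * (i j)%:R) + B%:R * (\sum_j w j * (i j)%:R).
  rewrite -[X in _ * (X - _)]mean_const -sumrB !mulr_sumr -big_split.
  by apply: eq_bigr => j _ /=; ring.
have xrE r : x ord0 r = \sum_j w j * (a j r)%:R.
  rewrite xE summxE; apply: eq_bigr => j _; have [_ <-] := aP j.
  by rewrite !mxE.
exists (\sum_j w j * (i j)%:R).
  rewrite sumr_ge0 => [|j _]; last by rewrite mulr_ge0.
  rewrite -[leRHS]mean_const; apply: ler_sum => j _.
  by rewrite ler_wpM2l // ler_nat; have [] := iP j.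
split.
  under eq_bigr do rewrite xrE.
  rewrite exchange_big /= -[RHS]mean_const; apply: eq_bigr => j _.
  rewrite -mulr_sumr -natr_sum -mdegE.
  by have [/(mem_segment_sum _ _ l_part m_part deg_eq)[-> _] _] := aP j.
move=> r; rewrite !xrE -!aveE; split; first by apply: sumr_ge0 => j _; rewrite mulr_ge0.
apply/andP; split; apply: ler_sum => j _; rewrite ler_wpM2l //;
  have [le_ijt /(_ r)/andP[lo hi]] := iP j;
  by rewrite -natrB // -!natrM -natrD ler_nat.
Qed.

(** The bounds at all coordinates hold together as soon as they hold for the
    largest and the smallest one, which is the form required by
    [integral_time]. *)
Lemma saturated_segment_sum t :
  (m ord0 < l ord0)%N -> (m ord_max < l ord_max)%N ->
  l ord0 = (m ord0).+1 \/ l ord_max = (m ord_max).+1 ->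
  saturated_Newton R (segment_sum l m t).
Proof.
move=> lt0 lt2 gap x [/Newt_segment_sum[T T_bounds [x_sum x_bounds]] [z _ zE]].
pose a : 'X_{1..3} := [multinom `|z ord0 r|%N | r < 3].
have xE r : x ord0 r = (a r)%:R.
  have [] := x_bounds r; rewrite -zE mxE mnmE ler0z => z_ge0 _.
  by rewrite -[RHS]/(((`|z ord0 r|%N)%:Z)%:~R) gez0_abs.
exists a; last by apply/rowP => r; rewrite mxE xE.
apply/(mem_segment_sum _ _ l_part m_part deg_eq); split.
  apply/eqP; rewrite -(eqr_nat R) -x_sum mdegE natr_sum.
  by apply/eqP/eq_bigr => r _; rewrite xE.
have upper r : (a r)%:R <= (l ord0)%:R * (t%:R - T) + (m ord0)%:R * T.
  by rewrite -xE; have [_ /andP[]] := x_bounds r.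
have lower r : (l ord_max)%:R * (t%:R - T) + (m ord_max)%:R * T <= (a r)%:R.
  by rewrite -xE; have [_ /andP[]] := x_bounds r.
pose hi := maxn (maxn (a ord0) (a mid3)) (a ord_max).
pose lo := minn (minn (a ord0) (a mid3)) (a ord_max).
have hi_le : hi%:R <= (l ord0)%:R * (t%:R - T) + (m ord0)%:R * T.
  by rewrite /hi /maxn; do 2?case: ifP => _; apply: upper.
have lo_ge : (l ord_max)%:R * (t%:R - T) + (m ord_max)%:R * T <= lo%:R.
  by rewrite /lo /minn; do 2?case: ifP => _; apply: lower.
have [i le_it [hi_i lo_i]] := integral_time T_bounds lt0 lt2 gap hi_le lo_ge.
exists i => //; apply: ord3P; rewrite /hi /lo in hi_i lo_i; lia.
Qed.

End Saturation.

Lemma segment_sumC l m t : segment_sum l m t = segment_sum m l t.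
Proof.
rewrite /segment_sum (reindex_inj rev_ord_inj); apply: eq_bigr => i _ /=.
by rewrite subSS subKn -1?ltnS // addmC.
Qed.

Theorem theorem4p3 (R : realType) (P : set 'rV[R]_3)
    (P_ge0 : forall x, P x -> forall i, 0 <= x ord0 i)
    (P_sym : symmetric_set P)
    (P_lattice : lattice_polytope P)
    (P_2max : two_partition_maximal P)
    (lambda mu : 'X_{1..3})
    (lambda_part : is_partition lambda)
    (mu_part : is_partition mu)
    (lambda_neq_mu : lambda <> mu)
    (size_eq : mdeg lambda = mdeg mu)
    (P_MLP : MLP P = [set lambda; mu])
    (t : nat) (t_gt0 : (0 < t)%N) :
  saturated_Newton R
    (\sum_(i < t.+1) schur (lambda *+ (t - i) + mu *+ i)%MM).
Proof.
have P_cvx : convex_subset P.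
  by have [s [_ ->]] := P_lattice; apply: conv_hull_convex.
have incomparable l m : MLP P l -> MLP P m -> l <> m -> ~ dominated l m.
  by move=> [_ max_l] [Pm _] neq_lm lm; apply: neq_lm; rewrite (max_l _ Pm lm).
have MLP_lambda : MLP P lambda by rewrite P_MLP; left.
have MLP_mu : MLP P mu by rewrite P_MLP; right.
have := incomparable _ _ MLP_lambda MLP_mu lambda_neq_mu.
have := incomparable _ _ MLP_mu MLP_lambda (nesym lambda_neq_mu).
rewrite (dominated3P size_eq) (dominated3P (esym size_eq)) => not_ml not_lm.
rewrite -/(segment_sum lambda mu t).
have [lt0|le0] := ltnP (mu ord0) (lambda ord0).
  have lt2 : (mu ord_max < lambda ord_max)%N.
    by rewrite ltnNge; apply/negP => le2; apply: not_ml; rewrite ltnW.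
  apply: saturated_segment_sum => //.
  exact: MLP_unit_gap P_cvx P_sym P_MLP size_eq lt0 lt2.
have lt2 : (lambda ord_max < mu ord_max)%N.
  by rewrite ltnNge; apply/negP => le2; apply: not_lm.
have lt0 : (lambda ord0 < mu ord0)%N.
  rewrite ltn_neqAle le0 andbT; apply/eqP => eq0.
  by apply: not_ml; rewrite eq0 leqnn ltnW.
rewrite segment_sumC; rewrite setUC in P_MLP.
apply: saturated_segment_sum => //.
exact: MLP_unit_gap P_cvx P_sym P_MLP (esym size_eq) lt0 lt2.
Qed.
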